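(* Let $s>1$ be an integer, let $\mathbf{x}_0\in\mathbb{R}^n$ be a nonzero $s$-sparse vector, and let $\mathbf{A}\in\mathbb{R}^{m\times n}$. Define $$c=c(\mathbf{A})=\sup_{\mathbf{0}\neq \mathbf{h}\in\ker(\mathbf{A})}\frac{\|\mathbf{h}\|_2^2}{\|\mathbf{h}\|_1^2},$$ and let $\rho=\rho(\mathbf{x}_0)$ and $\kappa=\kappa(\mathbf{x}_0)$. Suppose that $$\rho(\kappa+1)\le \frac{1}{2c},$$ and that $$\|\mathbf{h}_T\|_1<\frac{1}{2\kappa+1}\|\mathbf{h}_{T^\complement}\|_1\qquad\text{for every nonzero }\mathbf{h}\in\ker(\mathbf{A})\text{ and every } T\subset\{1,\dots,n\}\text{ with }|T|\le s.$$ Then $\mathbf{x}_0$ is a local minimizer of $\|\mathbf{x}\|_1/\|\mathbf{x}\|_2$ subject to $\mathbf{A}\mathbf{x}=\mathbf{A}\mathbf{x}_0$, with $\ell_1$ radius $\delta=\rho\,\|\mathbf{x}_0\|_\infty$; that is, for every $\mathbf{x}\in\mathbb{R}^n$ with $\mathbf{x}\ne\mathbf{x}_0$, $\mathbf{A}\mathbf{x}=\mathbf{A}\mathbf{x}_0$ and $\|\mathbf{x}-\mathbf{x}_0\|_1\le\delta$, $$\frac{\|\mathbf{x}_0\|_1}{\|\mathbf{x}_0\|_2}<\frac{\|\mathbf{x}\|_1}{\|\mathbf{x}\|_2}.$$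
   Context: A vector is $s$-sparse if it has at most $s$ nonzero entries. For a nonzero vector $\mathbf{x}_0=(x_1,\dots,x_n)^T$ with support $\mathrm{supp}(\mathbf{x}_0)=\{i: x_i\ne 0\}$, define $$\rho(\mathbf{x}_0)=\frac{\min_{i\in\mathrm{supp}(\mathbf{x}_0)}|x_i|}{\|\mathbf{x}_0\|_\infty},\qquad \kappa(\mathbf{x}_0)=\frac{\|\mathbf{x}_0\|_1\,\|\mathbf{x}_0\|_\infty}{\|\mathbf{x}_0\|_2^2}.$$ For $T\subset\{1,\dots,n\}$, $T^\complement=\{1,\dots,n\}\setminus T$, and $\mathbf{h}_T$ is the restriction of $\mathbf{h}$ to the index set $T$. If $\ker(\mathbf{A})=\{\mathbf{0}\}$, the condition involving $c$ is regarded as vacuous. *)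

(* Defs.v *)
From HB Require Import structures.
From mathcomp Require Import all_boot all_order all_algebra.
From mathcomp Require Import all_classical all_reals all_analysis.
Set Implicit Arguments.
Unset Strict Implicit.
Unset Printing Implicit Defensive.
Import Order.TTheory GRing.Theory Num.Theory.
Import numFieldNormedType.Exports.
Local Open Scope classical_set_scope.
Local Open Scope ring_scope.

Definition supp (R : realType) (n : nat) (x : 'cV[R]_n) : {set 'I_n} :=
  [set i | x i 0 != 0]%SET.

Definition sparse (R : realType) (n s : nat) (x : 'cV[R]_n) : Prop :=
  (#|supp x| <= s)%N.

Definition l1norm (R : realType) (n : nat) (x : 'cV[R]_n) : R :=
  \sum_(i < n) `|x i 0|.

Definition l2norm (R : realType) (n : nat) (x : 'cV[R]_n) : R :=
  Num.sqrt (\sum_(i < n) `|x i 0| ^+ 2).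

(* The library norm on matrices is the maximum of the absolute values of
   the entries. *)
Definition linfnorm (R : realType) (n : nat) (x : 'cV[R]_n) : R := `|x|.

(* The restriction to T keeps its ambient dimension: entries outside T are
   set to 0, which leaves the l1 norm unchanged. *)
Definition restr (R : realType) (n : nat) (T : {set 'I_n}) (x : 'cV[R]_n) :
    'cV[R]_n :=
  \col_i (if i \in T then x i 0 else 0).

(* The default value of the iterated minimum bounds every entry, so it does not
   affect the minimum over the support of a nonzero vector. *)
Definition rho (R : realType) (n : nat) (x : 'cV[R]_n) : R :=
  (\big[Num.min/linfnorm x]_(i in supp x) `|x i 0|) / linfnorm x.

Definition kappa (R : realType) (n : nat) (x : 'cV[R]_n) : R :=
  l1norm x * linfnorm x / l2norm x ^+ 2.

Definition nonzero_kernel (R : realType) (m n : nat) (A : 'M[R]_(m, n)) :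
    set 'cV[R]_n :=
  [set h | h != 0 /\ A *m h = 0].

(* For nonzero h the ratio is at most 1, so the supremum is a genuine one
   as soon as the kernel is nontrivial; otherwise its value is a dummy 0. *)
Definition cker (R : realType) (m n : nat) (A : 'M[R]_(m, n)) : R :=
  sup [set l2norm h ^+ 2 / l1norm h ^+ 2 | h in nonzero_kernel A].

(* Main.v *)
(* Write x = x0 + h with h in the kernel, T the support of x0, and let
   p = |h_T|_1, q = |h_(T^c)|_1, M = |x0|_inf. Then |x|_1 >= |x0|_1 + (q - p),
   while |x|_2^2 <= |x0|_2^2 + 2 M p + c (p + q)^2. The radius condition
   p + q <= rho M and 2 c rho (kappa + 1) <= 1 bound the quadratic term by
   M (p + q) / (2 (kappa + 1)), so to first order the ratio grows as soon as
   kappa (p + q) / (2 (kappa + 1)) + 2 kappa p < 2 (q - p), which follows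
   from (2 kappa + 1) p < q. *)
Require Import Defs.
From HB Require Import structures.
From mathcomp Require Import all_boot all_order all_algebra.
From mathcomp Require Import all_classical all_reals all_analysis.
From mathcomp Require Import ring lra.
Set Implicit Arguments.
Unset Strict Implicit.
Unset Printing Implicit Defensive.
Import Order.TTheory GRing.Theory Num.Theory.
Import numFieldNormedType.Exports.
Local Open Scope classical_set_scope.
Local Open Scope ring_scope.

Lemma l1norm_ge0 (R : realType) (n : nat) (x : 'cV[R]_n) : 0 <= l1norm x.
Proof. exact: sumr_ge0. Qed.

Lemma l1norm_gt0 (R : realType) (n : nat) (x : 'cV[R]_n) :
  x != 0 -> 0 < l1norm x.
Proof.
move=> /cV0Pn[i xi_neq0]; rewrite /l1norm (bigD1 i) //=.
by rewrite ltr_pwDl ?normr_gt0 ?sumr_ge0.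
Qed.

Lemma l2norm_sqr (R : realType) (n : nat) (x : 'cV[R]_n) :
  l2norm x ^+ 2 = \sum_(i < n) x i 0 ^+ 2.
Proof.
rewrite sqr_sqrtr; last by apply: sumr_ge0 => i _; exact: sqr_ge0.
by apply: eq_bigr => i _; rewrite real_normK ?num_real.
Qed.

Lemma l2norm_gt0 (R : realType) (n : nat) (x : 'cV[R]_n) :
  x != 0 -> 0 < l2norm x.
Proof.
move=> /cV0Pn[i xi_neq0]; rewrite sqrtr_gt0 (bigD1 i) //=.
by rewrite ltr_pwDl ?exprn_gt0 ?normr_gt0 ?sumr_ge0 // => j _; exact: exprn_ge0.
Qed.

Lemma l2norm_le_l1norm (R : realType) (n : nat) (x : 'cV[R]_n) :
  l2norm x ^+ 2 <= l1norm x ^+ 2.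
Proof.
rewrite l2norm_sqr expr2 /l1norm mulr_suml; apply: ler_sum => i _.
rewrite -[x i 0 ^+ 2]real_normK ?num_real // expr2 ler_wpM2l //.
by rewrite (bigD1 i) //= lerDl sumr_ge0.
Qed.

Lemma norm_entry_le_linfnorm (R : realType) (n : nat) (x : 'cV[R]_n)
    (i : 'I_n) : `|x i 0| <= linfnorm x.
Proof.
rewrite /linfnorm /Num.norm /= mx_normrE.
exact: (le_bigmax _ (fun ij : 'I_n * 'I_1 => `|x ij.1 ij.2|) (i, 0)).
Qed.

Lemma l1norm_restr (R : realType) (n : nat) (T : {set 'I_n})
    (x : 'cV[R]_n) : l1norm (restr T x) = \sum_(i in T) `|x i 0|.
Proof.
rewrite [RHS]big_mkcond; apply: eq_bigr => i _.
by rewrite mxE; case: ifP; rewrite ?normr0.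
Qed.

Lemma l1norm_restrC (R : realType) (n : nat) (T : {set 'I_n})
    (x : 'cV[R]_n) :
  l1norm x = l1norm (restr T x) + l1norm (restr (~: T)%SET x).
Proof.
rewrite !l1norm_restr [LHS](bigID (mem T)) /=; congr (_ + _).
by apply: eq_bigl => i; rewrite inE.
Qed.

Lemma notin_supp_eq0 (R : realType) (n : nat) (x : 'cV[R]_n) (i : 'I_n) :
  i \notin supp x -> x i 0 = 0.
Proof. by rewrite inE negbK => /eqP. Qed.

(** Entrywise: off the support the entry of [x] vanishes and [h] counts in full; on it, apply the
    triangle inequality to [x = (x + h) - h]. *)
Lemma l1normD_supp_ge (R : realType) (n : nat) (x h : 'cV[R]_n) :
  l1norm x + l1norm (restr (~: supp x)%SET h) - l1norm (restr (supp x) h)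
    <= l1norm (x + h).
Proof.
rewrite !l1norm_restr big_mkcond [\sum_(i in supp x) _]big_mkcond /=.
rewrite -big_split -sumrB; apply: ler_sum => i _ /=; rewrite [in X in _ <= X]mxE.
rewrite finset.in_setC; case: ifPn => [|/negPn] xi /=.
  by rewrite (negPf xi) subr0 (notin_supp_eq0 xi) normr0 !add0r.
by rewrite xi addr0 lerBlDr -[in X in X <= _](addrK (h i 0) (x i 0)) ler_normB.
Qed.

(** The cross term [2 x_i h_i] of each square vanishes off the support, which is why only the
    restriction of [h] to it appears. *)
Lemma l2normD_supp_le (R : realType) (n : nat) (x h : 'cV[R]_n) :
  l2norm (x + h) ^+ 2 <=
    l2norm x ^+ 2 + 2 * linfnorm x * l1norm (restr (supp x) h)
      + l2norm h ^+ 2.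
Proof.
rewrite !l2norm_sqr l1norm_restr [\sum_(i in supp x) _]big_mkcond mulr_sumr.
rewrite -!big_split /=.
apply: ler_sum => i _; rewrite mxE sqrrD lerD2r lerD2l -mulr_natl.
case: ifPn => xi; last by rewrite (notin_supp_eq0 xi) mul0r !mulr0.
rewrite -mulrA ler_pM2l //; apply: le_trans (ler_norm _) _.
by rewrite normrM ler_wpM2r // norm_entry_le_linfnorm.
Qed.

Lemma cker_bound (R : realType) (m n : nat) (A : 'M[R]_(m, n))
    (h : 'cV[R]_n) :
  nonzero_kernel A h -> l2norm h ^+ 2 / l1norm h ^+ 2 <= cker A.
Proof.
move=> Ah; apply: ub_le_sup; last by exists h.
(* [sup] dominates the ratios only once they are bounded above; 1 is such a bound. *)
exists 1 => _ [g [g_neq0 _] <-].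
by rewrite ler_pdivrMr ?mul1r ?l2norm_le_l1norm // exprn_gt0 ?l1norm_gt0.
Qed.

(* [a], [b], [M], [K], [r] stand for the l1 norm, squared l2 norm, sup norm,
   kappa and rho of [x0]; [p], [q], [H] for the l1 norms of [h] on and off the
   support and its squared l2 norm; [X], [Y] for the l1 norm and the squared
   l2 norm of [x0 + h]. *)
Lemma ratio_sqr_lt (R : realFieldType) (a b M K r c p q H X Y : R) :
  0 < a -> 0 < b -> 0 < K -> 0 < c -> 0 <= p -> K * b = a * M ->
  (2 * K + 1) * p < q -> H <= c * (p + q) ^+ 2 -> p + q <= r * M ->
  2 * c * (r * (K + 1)) <= 1 -> 0 <= M ->
  a + q - p <= X -> Y <= b + 2 * M * p + H -> a ^+ 2 * Y < b * X ^+ 2.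
Proof.
move=> a0 b0 K0 c0 p0 KE qp HE tr cr M0 XE YE.
have Kp0 : 0 <= K * p by rewrite mulr_ge0 // ltW.
(* The radius bound trades one factor [p + q] of the quadratic term for [M], so that [act] is linear
   in [p + q]. *)
have ct : 2 * c * (K + 1) * (p + q) <= M.
  apply: (@le_trans _ _ (2 * c * (K + 1) * (r * M))).
    by rewrite ler_wpM2l // !mulr_ge0 // ltW //; lra.
  have -> : 2 * c * (K + 1) * (r * M) = 2 * c * (r * (K + 1)) * M by ring.
  by rewrite ler_piMl.
have t0 : 0 <= p + q by lra.
have act : 2 * (K + 1) * (a * H) <= K * b * (p + q).
  rewrite KE; apply: (@le_trans _ _ (2 * (K + 1) * (a * (c * (p + q) ^+ 2)))).
    by rewrite ler_wpM2l ?ler_wpM2l //; lra.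
  have -> : 2 * (K + 1) * (a * (c * (p + q) ^+ 2))
    = a * (2 * c * (K + 1) * (p + q)) * (p + q) by ring.
  by rewrite ler_wpM2r // ler_wpM2l // ltW.
have gap : K * (p + q) + 4 * (K + 1) * (K * p) < 4 * (K + 1) * (q - p).
  (* [3 * K + 4] is the coefficient of [q] in right side minus left side; the remainder is
     [2 * K * (K + 1) * p]. *)
  have : 0 < (3 * K + 4) * (q - (2 * K + 1) * p) by rewrite mulr_gt0; lra.
  have : 0 <= K * (K * p) by rewrite mulr_ge0 // ltW.
  lra.
(* Comparison of the first-order terms of [a ^+ 2 * (b + 2 * M * p + H)] and
   [b * (a + (q - p)) ^+ 2], divided by [a]; the square [b * (q - p) ^+ 2] only helps. *)
have lin : a * (2 * M * p + H) < 2 * b * (q - p).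
  rewrite -(@ltr_pM2l _ (2 * (K + 1))); last by lra.
  have : b * (K * (p + q) + 4 * (K + 1) * (K * p)) < b * (4 * (K + 1) * (q - p)).
    by rewrite ltr_pM2l.
  have -> : 2 * (K + 1) * (a * (2 * M * p + H))
    = 2 * (K + 1) * (a * H) + 4 * (K + 1) * p * (a * M) by ring.
  rewrite -KE; lra.
have d0 : 0 < q - p by lra.
apply: (@lt_le_trans _ _ (b * (a + (q - p)) ^+ 2)); last first.
  by rewrite (ler_wpM2l (ltW b0)) // ler_sqr ?nnegrE; lra.
apply: (@le_lt_trans _ _ (a ^+ 2 * (b + 2 * M * p + H))).
  by rewrite ler_wpM2l // sqr_ge0.
have : a * (a * (2 * M * p + H)) < a * (2 * b * (q - p)) by rewrite ltr_pM2l.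
have : 0 <= b * (q - p) ^+ 2 by rewrite mulr_ge0 ?sqr_ge0 // ltW.
lra.
Qed.

Theorem theorem3p1 (R : realType) (m n s : nat) (A : 'M[R]_(m, n))
    (x0 : 'cV[R]_n)
    (s_gt1 : (1 < s)%N)
    (x0_neq0 : x0 != 0)
    (x0_sparse : sparse s x0)
    (c_bound : nonzero_kernel A !=set0 ->
       rho x0 * (kappa x0 + 1) <= 1 / (2 * cker A))
    (nsp : forall (h : 'cV[R]_n) (T : {set 'I_n}),
       nonzero_kernel A h -> (#|T| <= s)%N ->
       l1norm (restr T h) <
         1 / (2 * kappa x0 + 1) * l1norm (restr (~: T)%SET h)) :
  forall x : 'cV[R]_n,
    x != x0 -> A *m x = A *m x0 ->
    l1norm (x - x0) <= rho x0 * linfnorm x0 ->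
    l1norm x0 / l2norm x0 < l1norm x / l2norm x.
Proof.
move=> x x_neq Ax dx.
set h := x - x0 in dx; have xE : x = x0 + h by rewrite addrC subrK.
have Ah : nonzero_kernel A h.
  by split; rewrite ?subr_eq0 // mulmxBr Ax subrr.
have [h_neq0 _] := Ah.
have a0 := l1norm_gt0 x0_neq0; have l20 := l2norm_gt0 x0_neq0.
have b0 : 0 < l2norm x0 ^+ 2 by rewrite exprn_gt0.
have M0 : 0 < linfnorm x0 by rewrite normr_gt0.
have K0 : 0 < kappa x0 by rewrite divr_gt0 ?mulr_gt0.
have KE : kappa x0 * l2norm x0 ^+ 2 = l1norm x0 * linfnorm x0.
  by rewrite divfK ?gt_eqF.
have t0 := l1norm_gt0 h_neq0.
have c_ge := cker_bound Ah.
(* Positivity, from the ratio of [h] itself, allows clearing the denominator in [c_bound]. *)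
have c0 : 0 < cker A.
  by apply: lt_le_trans c_ge; rewrite divr_gt0 ?exprn_gt0 ?l2norm_gt0.
have HE : l2norm h ^+ 2 <= cker A * l1norm h ^+ 2.
  by rewrite -ler_pdivrMr ?exprn_gt0.
have cr : 2 * cker A * (rho x0 * (kappa x0 + 1)) <= 1.
  have := c_bound (ex_intro _ h Ah).
  by rewrite ler_pdivlMr ?mulr_gt0 // mulrC.
have := nsp h _ Ah x0_sparse.
rewrite mul1r mulrC ltr_pdivlMr; last by lra.
rewrite mulrC => qp.
have p0 := l1norm_ge0 (restr (supp x0) h).
have tE := l1norm_restrC (supp x0) h.
have XE := l1normD_supp_ge x0 h; have YE := l2normD_supp_le x0 h.
rewrite -xE in XE YE; rewrite tE in HE dx.
have main := ratio_sqr_lt a0 b0 K0 c0 p0 KE qp HE dx cr (ltW M0) XE YE.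
have Kp0 := mulr_ge0 (ltW K0) p0.
(* By [qp] and [Kp0] the mass of [h] off the support exceeds that on it, so [x] cannot be 0 and its
   quotient is genuine. *)
have X0 : 0 < l1norm x by apply: lt_le_trans XE; lra.
have x_neq0 : x != 0.
  apply: contraTneq X0 => ->; rewrite -leNgt /l1norm big1 // => i _.
  by rewrite mxE normr0.
have Y0 := l2norm_gt0 x_neq0.
rewrite ltr_pdivrMr // mulrAC ltr_pdivlMr //.
rewrite -ltr_sqr ?nnegrE ?mulr_ge0 ?ltW // !exprMn.
by rewrite [X in _ < X]mulrC.
Qed.
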